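(* Let $\mathfrak{P}=(D,\Sigma,(L_c)_{c\in\mathfrak{C}},d_0,\mathbf{m}_0)$ be an asynchronous program, and let ${\downarrow}\mathfrak{P}=(D,\Sigma,({\downarrow}L_c)_{c\in\mathfrak{C}},d_0,\mathbf{m}_0)$. Then ${\downarrow}\mathsf{Runs}({\downarrow}\mathfrak{P})={\downarrow}\mathsf{Runs}(\mathfrak{P})$. In particular, the following holds. (1) For every $d\in D$, $\mathfrak{P}$ can reach $d$ if and only if ${\downarrow}\mathfrak{P}$ can reach $d$. (2) $\mathfrak{P}$ is terminating if and only if ${\downarrow}\mathfrak{P}$ is terminating. (3) $\mathfrak{P}$ is bounded if and only if ${\downarrow}\mathfrak{P}$ is bounded.
   Context: Words. For words $w,w'\in\Sigma^*$, $w\sqsubseteq w'$ means $w$ can be obtained from $w'$ by deleting letters (scattered subword). For $L\subseteq\Sigma^*$, ${\downarrow}L=\{w'\in\Sigma^*\mid\exists w\in L\colon w'\sqsubseteq w\}$. Multisets. $\mathbb{M}[\Sigma]$ is the set of multisets $\mathbf{m}\colon\Sigma\to\mathbb{N}$; $\oplus$ is pointwise addition; $\mathbf{m}\preceq\mathbf{m}'$ is the pointwise order; $[\![\sigma]\!]$ contains $\sigma$ exactly once; $|\mathbf{m}|=\sum_\sigma\mathbf{m}(\sigma)$. $\mathsf{Parikh}(w)\in\mathbb{M}[\Sigma]$ maps each letter to its number of occurrences in $w\in\Sigma^*$. Asynchronous programs. An asynchronous program over a class $\mathcal{C}$ of languages ($\mathcal{C}$ being closed under intersection with regular languages, homomorphic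 images and inverse homomorphic images) is a tuple $\mathfrak{P}=(D,\Sigma,(L_c)_{c\in\mathfrak{C}},d_0,\mathbf{m}_0)$, where $D$ is a finite set of global states, $\Sigma$ is a finite alphabet of handler names, $\mathfrak{C}=D\times\Sigma\times D$, each $L_c\subseteq\Sigma^*$ is from $\mathcal{C}$, $d_0\in D$, and $\mathbf{m}_0\in\mathbb{M}[\Sigma]$. Configurations are pairs $(d,\mathbf{m})\in D\times\mathbb{M}[\Sigma]$. Transitions: $(d,\mathbf{m}\oplus[\![\sigma]\!])\xrightarrow{\sigma}(d',\mathbf{m}\oplus\mathbf{m}')$ iff there is $w\in L_{(d,\sigma,d')}$ with $\mathsf{Parikh}(w)=\mathbf{m}'$. Preruns and runs. A prerun is a finite or infinite sequence $\rho=(e_0,\mathbf{n}_0),\sigma_1,(e_1,\mathbf{n}_1),\sigma_2,\ldots$ alternating between elements of $D\times\mathbb{M}[\Sigma]$ and symbols of $\Sigma$; its length $|\rho|$ is its number of configurations. For preruns $\rho$ and $\rho'=(e'_0,\mathbf{n}'_0),\sigma'_1,(e'_1,\mathbf{n}'_1),\ldots$ we write $\rho\trianglelefteq\rho'$ if $|\rho|=|\rho'|$ and for each $i$, $e_i=e'_i$, $\sigma_i=\sigma'_i$ and $\mathbf{n}_i\preceq\mathbf{n}'_i$. For a set $R$ of preruns, ${\downarrow}R=\{\rho\text{ a prerun}\mid\exists\rho'\in R\colon\rho\trianglelefteq\rho'\}$. A run of $\mathfrak{P}$ is a prerun $(d_0,\mathbf{m}_0),\sigma_1,(d_1,\mathbf{m}_1),\sigma_2,\ldots$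 starting with the initial configuration $(d_0,\mathbf{m}_0)$ such that $(d_i,\mathbf{m}_i)\xrightarrow{\sigma_{i+1}}(d_{i+1},\mathbf{m}_{i+1})$ for each $i$; $\mathsf{Runs}(\mathfrak{P})$ is the set of all (finite and infinite) runs. A configuration is reachable if it occurs on some run; $\mathfrak{P}$ can reach $d$ if some reachable configuration has global state $d$. $\mathfrak{P}$ is terminating if all its runs are finite. $\mathfrak{P}$ is bounded if there is $N\in\mathbb{N}$ with $|\mathbf{m}|\le N$ for every reachable configuration $(d,\mathbf{m})$. *)

(* Defs.v *)
From mathcomp Require Import all_boot.
From mathcomp Require Import finmap multiset boolp classical_sets.

Set Implicit Arguments.
Unset Strict Implicit.
Unset Printing Implicit Defensive.

Local Open Scope mset_scope.
Local Open Scope classical_set_scope.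

Definition language (A : finType) := set (seq A).

Definition dclosure_lang (A : finType) (L : language A) : language A :=
  [set w' | exists2 w, L w & subseq w' w].

(* The free-monoid homomorphism A^* -> B^* extending a letter map; letters may
   be erased. *)
Definition hom_ext (A B : finType) (h : A -> seq B) (w : seq A) : seq B :=
  flatten [seq h a | a <- w].

Definition regular (A : finType) (L : language A) : Prop :=
  exists (Q : finType) (q0 : Q) (delta : Q -> A -> Q) (F : {set Q}),
    L = [set w | foldl delta q0 w \in F].

Definition language_class := forall A : finType, set (language A).

Record full_trio (C : language_class) : Prop := FullTrio {
  trio_regular : forall (A : finType) (L K : language A),
    C A L -> regular K -> C A (L `&` K);
  trio_hom : forall (A B : finType) (h : A -> seq B) (L : language A),
    C A L -> C B (hom_ext h @` L);
  trio_invhom : forall (A B : finType) (h : A -> seq B) (L : language B),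
    C B L -> C A (hom_ext h @^-1` L)
}.

Record async_program (D Sigma : finType) := AsyncProgram {
  handler : D * Sigma * D -> language Sigma;
  init_state : D;
  init_mset : {mset Sigma}
}.

Definition program_over (C : language_class) (D Sigma : finType)
    (P : async_program D Sigma) : Prop :=
  forall c, C Sigma (handler P c).

Definition dclosure_program (D Sigma : finType) (P : async_program D Sigma) :
    async_program D Sigma :=
  AsyncProgram (fun c => dclosure_lang (handler P c))
    (init_state P) (init_mset P).

Definition config (D Sigma : finType) : Type := (D * {mset Sigma})%type.

Definition mset_card (Sigma : finType) (m : {mset Sigma}) : nat :=
  \sum_(s : Sigma) m s.

Definition parikh (Sigma : finType) (w : seq Sigma) : {mset Sigma} :=
  seq_mset w.

Definition step (D Sigma : finType) (P : async_program D Sigma)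
    (c : config D Sigma) (s : Sigma) (c' : config D Sigma) : Prop :=
  exists m m' : {mset Sigma},
    [/\ c.2 = (m `+` [mset s])%mset,
        c'.2 = (m `+` m')%mset &
        exists2 w, handler P (c.1, s, c'.1) w & parikh w = m'].

(* [FinPrerun c0 [:: (s1, c1); ..; (sn, cn)]] is the finite prerun
   c0, s1, c1, .., sn, cn; [InfPrerun c s] is the infinite prerun
   c 0, s 0, c 1, s 1, c 2, and so on. *)
Inductive prerun (D Sigma : finType) : Type :=
| FinPrerun of config D Sigma & seq (Sigma * config D Sigma)
| InfPrerun of (nat -> config D Sigma) & (nat -> Sigma).

(* The number of configurations, [None] standing for infinity. *)
Definition prerun_length (D Sigma : finType) (rho : prerun D Sigma) :
    option nat :=
  match rho with
  | FinPrerun _ r => Some (size r).+1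
  | InfPrerun _ _ => None
  end.

Definition conf_at (D Sigma : finType) (rho : prerun D Sigma) (i : nat) :
    option (config D Sigma) :=
  match rho with
  | FinPrerun c0 r => onth (c0 :: [seq x.2 | x <- r]) i
  | InfPrerun c _ => Some (c i)
  end.

(* The symbol between the configurations of indices [i] and [i.+1]. *)
Definition sym_at (D Sigma : finType) (rho : prerun D Sigma) (i : nat) :
    option Sigma :=
  match rho with
  | FinPrerun _ r => onth [seq x.1 | x <- r] i
  | InfPrerun _ s => Some (s i)
  end.

Definition prerun_le (D Sigma : finType) (rho rho' : prerun D Sigma) : Prop :=
  [/\ prerun_length rho = prerun_length rho',
      forall i, sym_at rho i = sym_at rho' i &
      forall i c c', conf_at rho i = Some c -> conf_at rho' i = Some c' ->
        c.1 = c'.1 /\ (c.2 `<=` c'.2)%mset].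

Definition dclosure_preruns (D Sigma : finType) (R : set (prerun D Sigma)) :
    set (prerun D Sigma) :=
  [set rho | exists2 rho', R rho' & prerun_le rho rho'].

Definition runs (D Sigma : finType) (P : async_program D Sigma) :
    set (prerun D Sigma) :=
  [set rho | conf_at rho 0 = Some (init_state P, init_mset P) /\
    forall i c s c',
      conf_at rho i = Some c -> sym_at rho i = Some s ->
      conf_at rho i.+1 = Some c' -> step P c s c'].

Definition reachable (D Sigma : finType) (P : async_program D Sigma)
    (c : config D Sigma) : Prop :=
  exists2 rho, runs P rho & exists i, conf_at rho i = Some c.

Definition can_reach (D Sigma : finType) (P : async_program D Sigma) (d : D) :
    Prop :=
  exists2 c, reachable P c & c.1 = d.

Definition terminating (D Sigma : finType) (P : async_program D Sigma) : Prop :=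
  forall rho, runs P rho -> exists n, prerun_length rho = Some n.

Definition bounded (D Sigma : finType) (P : async_program D Sigma) : Prop :=
  exists N : nat, forall c, reachable P c -> mset_card c.2 <= N.

(* Main.v *)
(* The multiset component only ever enables handlers: if a step of the
   downward-closed program goes from [c] to [c'] by means of a subword of some
   [w] in the original handler language, then from any configuration above [c]
   the step that posts all of [w] leads above [c'].  Iterating this (with
   dependent choice for infinite runs) puts a run of the original program above
   each run of the downward-closed one. *)

Require Import Defs.
From mathcomp Require Import all_boot.
From mathcomp Require Import finmap multiset boolp classical_sets.

Set Implicit Arguments.
Unset Strict Implicit.
Unset Printing Implicit Defensive.

Definition config_le (D Sigma : finType) (c c' : config D Sigma) : Prop :=
  c.1 = c'.1 /\ (c.2 `<=` c'.2)%mset.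

Lemma config_le_refl (D Sigma : finType) (c : config D Sigma) : config_le c c.
Proof. by split=> //; apply: msubset_refl. Qed.

Lemma config_le_trans (D Sigma : finType) (c1 c2 c3 : config D Sigma) :
  config_le c1 c2 -> config_le c2 c3 -> config_le c1 c3.
Proof.
move=> [e12 l12] [e23 l23]; split; first by rewrite e12.
exact: msubset_trans l12 l23.
Qed.

Lemma parikh_subseq (Sigma : finType) (w w' : seq Sigma) :
  subseq w w' -> (parikh w `<=` parikh w')%mset.
Proof.
by move=> sub_ww'; apply/msubsetP => s; rewrite !mset_seqE leq_count_subseq.
Qed.

Lemma mset_card_le (Sigma : finType) (m m' : {mset Sigma}%mset) :
  (m `<=` m')%mset -> mset_card m <= mset_card m'.
Proof. by move/msubsetP => le_mm'; apply: leq_sum => s _. Qed.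

Lemma step_dclosure (D Sigma : finType) (P : async_program D Sigma)
    (c c' : config D Sigma) (s : Sigma) :
  step P c s c' -> step (dclosure_program P) c s c'.
Proof.
move=> [m [m' [c2E c'2E [w Lw wE]]]]; exists m, m'; split=> //.
by exists w => //; exists w.
Qed.

Lemma runs_dclosure (D Sigma : finType) (P : async_program D Sigma)
    (rho : prerun D Sigma) :
  runs P rho -> runs (dclosure_program P) rho.
Proof.
move=> [rho0 rhoS]; split=> // i c s c' ci si ci1.
by apply: step_dclosure; apply: rhoS ci si ci1.
Qed.

Lemma dclosure_step_simulated (D Sigma : finType) (P : async_program D Sigma)
    (c c' b : config D Sigma) (s : Sigma) :
  step (dclosure_program P) c s c' -> config_le c b ->
  exists2 b', step P b s b' & config_le c' b'.
Proof.
move=> [m [m' [c2E c'2E [v [w Lw sub_vw] vE]]]] [cb1 cb2].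
have le_ms : (m `+` [mset s] `<=` b.2)%mset by rewrite -c2E.
(* The handler consumes one [s] from [b] and posts the full word [w] instead of its subword [v];
   [le_ms] guarantees that this [s] is present. *)
exists (c'.1, ((b.2 `\` [mset s]) `+` parikh w)%mset).
  exists (b.2 `\` [mset s])%mset, (parikh w); split=> //=.
    rewrite msetBDK //; apply: msubset_trans le_ms.
    by apply/msubsetP => x; rewrite msetE2 leq_addl.
  by exists w => //; rewrite -cb1.
split=> //=; rewrite c'2E -vE; apply: msetDSS; last exact: parikh_subseq.
(* Writing [m] as [m] plus [s] minus [s] reduces the goal to [le_ms] by monotonicity of
   subtraction. *)
by rewrite -[X in (X `<=` _)%mset](msetDKBC [mset s]%mset); apply: msetSB.
Qed.

(** Taking length and symbols from [rho] lets finite and infinite preruns share one total sequence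
    [b]; values of [b] past the end of a finite [rho] are dropped. The [iota] starts at 1 because
    [b 0] is the head. *)
Definition relabel {D Sigma : finType} (rho : prerun D Sigma)
    (b : nat -> config D Sigma) : prerun D Sigma :=
  match rho with
  | FinPrerun _ r =>
      FinPrerun (b 0) (zip [seq x.1 | x <- r] [seq b i | i <- iota 1 (size r)])
  | InfPrerun _ s => InfPrerun b s
  end.

Lemma prerun_length_relabel (D Sigma : finType) (rho : prerun D Sigma) b :
  prerun_length (relabel rho b) = prerun_length rho.
Proof.
by case: rho => //= _ r; rewrite size_zip !size_map size_iota minnn.
Qed.

Lemma sym_at_relabel (D Sigma : finType) (rho : prerun D Sigma) b i :
  sym_at (relabel rho b) i = sym_at rho i.
Proof.
by case: rho => //= _ r; rewrite -/unzip1 unzip1_zip // !size_map size_iota.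
Qed.

Lemma conf_at_relabel (D Sigma : finType) (rho : prerun D Sigma) b i :
  conf_at (relabel rho b) i = omap (fun=> b i) (conf_at rho i).
Proof.
case: rho i => [c0 r|//] [|i] //=.
rewrite -/unzip2 unzip2_zip ?size_map ?size_iota // !onth_map.
have [lt_ir|le_ri] := ltnP i (size r); last first.
  by rewrite !onth_default ?size_iota.
rewrite onthE (nth_map 0) ?size_iota // nth_iota //= add1n.
by move: lt_ir; rewrite -onthTE; case: onth.
Qed.

(** Whether an index carries a configuration depends on the length alone, so preruns of equal length
    are defined at the same indices. *)
Lemma conf_atE (D Sigma : finType) (rho : prerun D Sigma) i :
  conf_at rho i = (if prerun_length rho is Some n then i < n else true) :> bool.
Proof. by case: rho => //= c0 r; rewrite onthTE /= size_map. Qed.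

Lemma conf_at_le (D Sigma : finType) (rho rho' : prerun D Sigma) i c :
  prerun_le rho rho' -> conf_at rho i = Some c ->
  exists2 c', conf_at rho' i = Some c' & config_le c c'.
Proof.
move=> [eq_len _ le_conf] ci; move: (conf_atE rho i) (conf_atE rho' i).
rewrite ci -eq_len => <-; case c'i: conf_at => [c'|] // _.
by exists c' => //; apply: le_conf ci c'i.
Qed.

Lemma conf_at_pred (D Sigma : finType) (rho : prerun D Sigma) i c' :
  conf_at rho i.+1 = Some c' ->
  exists c s, conf_at rho i = Some c /\ sym_at rho i = Some s.
Proof.
case: rho => [c0 r|b s] /=; last by exists (b i), (s i).
rewrite onth_map => ri.
have lt_ir : i < size r by rewrite -onthTE; case: onth ri.
move: (onthTE (c0 :: unzip2 r) i) (onthTE (unzip1 r) i) => /=.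
rewrite !size_map lt_ir ltnS ltnW //.
by case: onth => // c _; case: onth => // s _; exists c, s.
Qed.

(** [prerun_le] compares configurations only where both exist, so the middle one must first be
    produced, by [conf_at_le]. *)
Lemma prerun_le_trans (D Sigma : finType) (rho1 rho2 rho3 : prerun D Sigma) :
  prerun_le rho1 rho2 -> prerun_le rho2 rho3 -> prerun_le rho1 rho3.
Proof.
move=> le12 le23; have [len12 sym12 _] := le12; have [len23 sym23 le_conf] := le23.
split=> [|i|i c1 c3 c1i c3i]; [by rewrite len12 | by rewrite sym12 |].
have [c2 c2i lec12] := conf_at_le le12 c1i.
by apply: config_le_trans lec12 _; apply: le_conf c2i c3i.
Qed.

Lemma dclosure_runs_dominated (D Sigma : finType) (P : async_program D Sigma)
    (rho : prerun D Sigma) :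
  runs (dclosure_program P) rho -> exists2 rho', runs P rho' & prerun_le rho rho'.
Proof.
move=> [rho0 rhoS].
(* Choice needs a successor for every pair of an index and a configuration, so domination is made a
   premise here and established only later, along the sequence [b]. *)
have /choice [next nextP] (x : nat * config D Sigma) :
    exists b', forall c s c', conf_at rho x.1 = Some c ->
      sym_at rho x.1 = Some s -> conf_at rho x.1.+1 = Some c' ->
      config_le c x.2 -> step P x.2 s b' /\ config_le c' b'.
  case: x => i b /=; have [[c [s [c' [ci si c'i le_cb]]]]|stuck] :=
    pselect (exists c s c', [/\ conf_at rho i = Some c, sym_at rho i = Some s,
      conf_at rho i.+1 = Some c' & config_le c b]).
    have [b' stepb le_c'b'] := dclosure_step_simulated (rhoS _ _ _ _ ci si c'i) le_cb.
    by exists b' => c1 s1 c1'; rewrite ci si c'i => -[<-] [<-] [<-].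
  (* Past the end of [rho], or when [b] does not dominate, the requirement is vacuous and any value
     will do. *)
  by exists b => c s c' ci si c'i le_cb; case: stuck; exists c, s, c'.
pose b := fix b i :=
  if i is j.+1 then next (j, b j) else (init_state P, init_mset P).
(* This invariant discharges the domination premise of [nextP] at every index, giving both the steps
   of the new run and its position above [rho]. *)
have le_b i c : conf_at rho i = Some c -> config_le c (b i).
  elim: i c => [|i IHi] c' c'i.
    by move: c'i; rewrite rho0 => -[<-]; apply: config_le_refl.
  have [c [s [ci si]]] := conf_at_pred c'i.
  by have [] := nextP (i, b i) _ _ _ ci si c'i (IHi _ ci).
exists (relabel rho b); split.
- by rewrite conf_at_relabel rho0.
- move=> i bi s bi1; rewrite !conf_at_relabel sym_at_relabel.
  case ci: conf_at => [c|] //= -[<-] si; case c'i: conf_at => [c'|] //= -[<-].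
  by have [] := nextP (i, b i) _ _ _ ci si c'i (le_b _ _ ci).
- by rewrite prerun_length_relabel.
- by move=> i; rewrite sym_at_relabel.
- by move=> i c c' ci; rewrite conf_at_relabel ci => -[<-]; apply: le_b.
Qed.

Lemma reachable_dclosure (D Sigma : finType) (P : async_program D Sigma) c :
  reachable P c -> reachable (dclosure_program P) c.
Proof. by move=> [rho /runs_dclosure runrho rhoc]; exists rho. Qed.

Lemma dclosure_reachable_dominated (D Sigma : finType)
    (P : async_program D Sigma) c :
  reachable (dclosure_program P) c -> exists2 c', reachable P c' & config_le c c'.
Proof.
move=> [rho /dclosure_runs_dominated [rho' runrho' le_rho] [i ci]].
have [c' c'i le_cc'] := conf_at_le le_rho ci.
by exists c' => //; exists rho' => //; exists i.
Qed.

Theorem proposition3p3 (C : language_class) (hC : full_trio C)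
    (D Sigma : finType) (P : async_program D Sigma) (hP : program_over C P) :
  dclosure_preruns (runs (dclosure_program P)) = dclosure_preruns (runs P) /\
  (forall d : D, can_reach P d <-> can_reach (dclosure_program P) d) /\
  (terminating P <-> terminating (dclosure_program P)) /\
  (bounded P <-> bounded (dclosure_program P)).
Proof.
split; [|split; [|split]].
- apply/seteqP; split=> rho [rho' runrho' le_rho].
    have [rho'' runrho'' le_rho'] := dclosure_runs_dominated runrho'.
    by exists rho'' => //; apply: prerun_le_trans le_rho le_rho'.
  by exists rho' => //; apply: runs_dclosure.
- move=> d; split=> [[c /reachable_dclosure reachc cd]|]; first by exists c.
  move=> [c /dclosure_reachable_dominated [c' reachc' [cc' _]] cd].
  by exists c' => //; rewrite -cc'.
- split=> term rho; last by move/runs_dclosure/term.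
  (* Domination preserves length, so the dominating run being finite makes [rho] finite. *)
  by move=> /dclosure_runs_dominated [rho' /term [n len] [-> _ _]]; exists n.
(* The same bound serves both programs, since a dominating configuration is at least as large. *)
- split=> -[N leN]; exists N => c; last by move/reachable_dclosure/leN.
  move=> /dclosure_reachable_dominated [c' /leN le_c'N [_ /mset_card_le le_cc']].
  exact: leq_trans le_cc' le_c'N.
Qed.
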